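(* Let $k,n,d\in\mathbb{N}$. Then $$ k\text{-}\mathrm{disp}^*(n,d) \;\ge\; \frac18\,\min\left\{1,\; \frac{k+\log_2(d)}{n}\right\}. $$
   Context: $\mathbb{N}=\{1,2,3,\dots\}$. Let $d,n\in\mathbb{N}$ and $k\in\mathbb{N}\cup\{0\}$. Let $\mathscr{B}^d_{\mathrm{ax}}$ denote the collection of all axis-parallel boxes inside the $d$-dimensional cube $[0,1]^d$, i.e. all sets $\mathbb{B}=I_1\times\dots\times I_d\subset[0,1]^d$ where each $I_\ell\subset[0,1]$ is an interval. Let $\mathrm{vol}_d$ denote $d$-dimensional Lebesgue measure and $\#$ the cardinality of a set. For a point set $\mathscr{P}_n=\{x_1,\dots,x_n\}\subset[0,1]^d$ of cardinality $n$, the $k$-dispersion is $$ k\text{-}\mathrm{disp}(\mathscr{P}_n,d) := \sup\Big\{\mathrm{vol}_d(\mathbb{B})\,:\, \mathbb{B}\in\mathscr{B}^d_{\mathrm{ax}} \text{ with } \#(\mathscr{P}_n\cap\mathbb{B})\le k\Big\}. $$ The minimal $k$-dispersion is $$ k\text{-}\mathrm{disp}^*(n,d) := \inf_{\substack{\mathscr{P}_n\subset[0,1]^d\\ \#\mathscr{P}_n=n}} k\text{-}\mathrm{disp}(\mathscr{P}_n,d). $$ *)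

(* Defs.v *)
From mathcomp Require Import all_boot all_order all_algebra.
From mathcomp Require Import all_classical all_reals all_analysis.
Import Order.TTheory GRing.Theory Num.Theory.
Import numFieldNormedType.Exports.

Set Implicit Arguments.
Unset Strict Implicit.
Unset Printing Implicit Defensive.

Local Open Scope classical_set_scope.
Local Open Scope ring_scope.

(* Points of R^d are d-tuples; [measurableTypeR R] is R with its Borel
   sigma-algebra, so [Rpoint R d] carries the product (= Borel) sigma-algebra. *)
Definition Rpoint (R : realType) (d : nat) : Type := d.-tuple (measurableTypeR R).

(* d-dimensional Lebesgue measure on Borel sets, as the d-fold product of the
   one-dimensional one: the product measure on R * R^d is transported to
   R^(d+1) along (x, t) |-> x :: t, and R^0 gets the unit point mass. *)
Fixpoint vol (R : realType) (d : nat) : set (Rpoint R d) -> \bar R :=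
  match d return set (Rpoint R d) -> \bar R with
  | 0 => \d_([tuple] : 0.-tuple (measurableTypeR R))
  | d'.+1 =>
      pushforward (lebesgue_measure \x @vol R d')%E
        (fun p : measurableTypeR R * d'.-tuple (measurableTypeR R) =>
           [tuple of p.1 :: p.2])
  end.
Arguments vol {R d}.

Definition unit_cube (R : realType) (d : nat) : set (Rpoint R d) :=
  [set x | forall l : 'I_d, 0 <= tnth x l <= 1].
Arguments unit_cube {R d}.

(* [is_interval] is order-convexity, so the sides may be open, closed or
   half-open, and degenerate or empty. *)
Definition axis_box (R : realType) (d : nat) : set (set (Rpoint R d)) :=
  [set B | exists I : 'I_d -> set R,
     [/\ forall l, is_interval (I l),
         forall l, I l `<=` [set t | 0 <= t <= 1]
       & B = [set x | forall l, I l (tnth x l)]]].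
Arguments axis_box {R d}.

Definition disp (R : realType) (k d : nat) (P : set (Rpoint R d)) : \bar R :=
  ereal_sup [set vol B | B in
    [set B | axis_box B /\ ((P `&` B) #<= `I_k)%card]].

Definition disp_min (R : realType) (k n d : nat) : \bar R :=
  ereal_inf [set disp k P | P in
    [set P : set (Rpoint R d) | P `<=` unit_cube /\ (P #= `I_n)%card]].

Definition log2 (R : realType) (x : R) : R := ln x / ln 2.

(* Main.v *)
(* With m the integer part of log2 d, cut the cube into N = n / (k + m + 1) + 1
   slabs orthogonal to the first axis: one of them contains at most k + m
   points. Discard k of these. Since d >= 2 ^ m, a pigeonhole argument on the
   halves of the slab in which the remaining m points lie provides a box that
   avoids them and fills a quarter of the slab. The slabs are taken open, so
   that they are disjoint. *)
Require Import Defs.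
From mathcomp Require Import all_boot all_order all_algebra.
From mathcomp Require Import all_classical all_reals all_analysis.
From mathcomp Require Import ring lra.
Import Order.TTheory GRing.Theory Num.Theory.
Local Open Scope classical_set_scope.
Local Open Scope ring_scope.

Lemma vol_set0 (R : realType) (d : nat) : vol (set0 : set (Rpoint R d)) = 0%E.
Proof.
elim: d => [|d IHd] /=; first by rewrite diracE in_set0.
rewrite /pushforward preimage_set0 /product_measure1.
by apply: integral0_eq => x _ /=; rewrite xsection0 IHd.
Qed.

Definition open_box (R : realType) (d : nat) (lo hi : 'I_d -> R) :
    set (Rpoint R d) :=
  [set x | forall l, lo l < tnth x l < hi l].

(** Induction on [d]: the section at a first coordinate [x] is the box in the remaining coordinates
    when [x] lies in the first side, and is empty otherwise. The integrand is thus a constant times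
    the indicator of that side. *)
Lemma vol_open_box (R : realType) (d : nat) (lo hi : 'I_d -> R) :
    (forall l, lo l <= hi l) ->
  vol (open_box R d lo hi) =
    (\prod_(l < d) (hi l - lo l))%:E.
Proof.
elim: d lo hi => [|d IHd] lo hi lohi /=.
  by rewrite big_ord0 diracE mem_set//= => -[].
rewrite /pushforward /product_measure1.
pose I0 : set (measurableTypeR R) := `]lo ord0, hi ord0[%classic.
pose c := (\prod_(l < d) (hi (lift ord0 l) - lo (lift ord0 l)))%:E.
transitivity (\int[@lebesgue_measure R]_(x in I0) cst c x)%E.
  rewrite [RHS]integral_mkcond; apply: eq_integral => x _ /=.
  rewrite patchE; case: ifPn => [/set_mem xI|/negP xI].
    rewrite /c -(IHd (fun l => lo (lift ord0 l)) (fun l => hi (lift ord0 l)))//.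
    congr vol; apply/seteqP; split=> t /=.
      rewrite /xsection/= => /set_mem/= H l.
      by have := H (lift ord0 l); rewrite tnthS.
    rewrite /xsection/= => H; apply/mem_set => /= l.
    by case: (unliftP ord0 l) => [j ->|->]; rewrite ?tnthS ?tnth0.
  rewrite -[RHS](vol_set0 R d); congr vol; apply/seteqP; split=> t //=.
  rewrite /xsection/= => /set_mem/= /(_ ord0); rewrite tnth0 => H.
  by apply: xI; apply/mem_set.
rewrite integral_cst; last exact: measurable_itv.
have mI0 : lebesgue_measure I0 = (hi ord0 - lo ord0)%:E.
  apply: etrans (lebesgue_measure_itv `]lo ord0, hi ord0[) _ => /=.
  rewrite lte_fin; case: ltP => // hilo.
  have -> : hi ord0 = lo ord0 by apply/le_anti; rewrite hilo lohi.
  by rewrite subrr.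
transitivity (c * (hi ord0 - lo ord0)%:E)%E; first by congr (_ * _)%E.
by rewrite /c -EFinM mulrC big_ord_recl.
Qed.

Lemma axis_open_box (R : realType) (d : nat) (lo hi : 'I_d -> R) :
    (forall l, 0 <= lo l) -> (forall l, hi l <= 1) ->
  axis_box (open_box R d lo hi).
Proof.
move=> lo0 hi1; exists (fun l => `]lo l, hi l[%classic); split => // [l|l t /=].
  exact: interval_is_interval.
rewrite in_itv/= => /andP[lot thi].
by rewrite (le_trans (lo0 l) (ltW lot)) (le_trans (ltW thi) (hi1 l)).
Qed.

(** The case [i = j] is allowed: the product is then only halved. A box cut in one direction and a
    box cut in two are thus treated together. *)
Lemma prod_halve_le (R : realFieldType) (d : nat) (s t : 'I_d -> R) (i j : 'I_d) :
    (forall l, 0 <= s l) ->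
    (forall l, l != i -> l != j -> t l = s l) ->
    t i = s i / 2 -> t j = s j / 2 ->
  4^-1 * \prod_l s l <= \prod_l t l.
Proof.
move=> s0 tE ti tj.
have P0 (P : pred 'I_d) : 0 <= \prod_(l | P l) s l by apply: prodr_ge0.
rewrite (bigD1 i)//= [leRHS](bigD1 i)//= ti.
have [ij|ij] := eqVneq i j.
  rewrite [X in _ <= _ * X](eq_bigr s) => [|l li]; last by rewrite tE// -ij.
  have := mulr_ge0 (s0 i) (P0 (fun l => l != i)); lra.
rewrite (bigD1 j) 1?eq_sym//= [in leRHS](bigD1 j) 1?eq_sym//= tj.
rewrite [X in _ <= _ * (_ * X)](eq_bigr s) => [|l /andP[]]; last exact: tE.
by rewrite le_eqVlt; apply/orP; left; apply/eqP; field.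
Qed.

(* Record for each coordinate on which side of the middle the points lie. The
   [d] words obtained, together with the zero word, are more than [2 ^ size s],
   hence two of them agree. *)
Lemma empty_quarter_box (R : realType) (d : nat) (a b : 'I_d -> R)
    (s : seq (Rpoint R d)) :
    (forall l, a l <= b l) -> (2 ^ size s <= d)%N ->
  exists lo hi : 'I_d -> R,
    [/\ forall l, a l <= lo l, forall l, lo l <= hi l, forall l, hi l <= b l,
        forall x, x \in s -> ~ open_box R d lo hi x
      & 4^-1 * \prod_l (b l - a l) <= \prod_l (hi l - lo l)].
Proof.
move=> ab sd.
pose mid l := (a l + b l) / 2.
have amid l : a l <= mid l by rewrite /mid; have := ab l; lra.
have midb l : mid l <= b l by rewrite /mid; have := ab l; lra.
pose side (l : 'I_d) (x : Rpoint R d) := tnth x l < mid l.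
pose word (o : option 'I_d) : {ffun 'I_(size s) -> bool} :=
  [ffun r => if o is Some l then side l (tnth (in_tuple s) r) else false].
have [/injectiveP winj|/injectivePn[u [v uv wE]]] := boolP (injectiveb word).
  have := leq_card _ winj.
  by rewrite card_option card_ffun card_bool !card_ord ltnNge sd.
have same_side i j : word (Some i) = word (Some j) ->
    forall x, x \in s -> side i x = side j x.
  move=> /ffunP wij x /seq_tnthP[r ->]; have := wij r.
  by rewrite !ffunE.
have low_side i : word (Some i) = word None -> forall x, x \in s -> ~~ side i x.
  move=> /ffunP wi x /seq_tnthP[r ->]; have := wi r.
  by rewrite !ffunE => ->.
(* Distinct [u] and [v] are not both [None]; by symmetry [u] is a coordinate. *)
wlog [i ui] : u v uv wE / exists i, u = Some i.
  move=> wlg; case: u v uv wE => [i|] v uv wE.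
    by apply: (wlg _ _ uv wE); exists i.
  case: v uv wE => // j uv wE.
  by apply: (wlg (Some j) None) => //; exists j.
move: uv wE; rewrite {u}ui; case: v => [j|]; last first.
  (* The word of [i] is zero: no point lies below the middle in direction [i], so the lower half in
     that direction avoids them all. *)
  move=> _ /low_side si; exists a, (fun l => if l == i then mid l else b l); split=> //.
  - by move=> l; case: ifP.
  - by move=> l; case: ifP.
  - move=> x /si /negP nx /(_ i); rewrite eqxx => /andP[_].
    exact: nx.
  - apply: (@prod_halve_le _ _ _ _ i i); rewrite ?eqxx.
    + by move=> l; rewrite subr_ge0.
    + by move=> l /negbTE ->.
    + by rewrite /mid; field.
    + by rewrite /mid; field.
move=> uv /same_side sij; have ij : i != j by [].
(* Lower half in direction [i], upper half in direction [j]: a point inside would lie on different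
   sides in the two directions, against the equality of the words. *)
exists (fun l => if l == j then mid l else a l).
exists (fun l => if l == i then mid l else b l); split.
- by move=> l; case: ifP.
- by move=> l; case: (eqVneq l j) => [->|lj]; case: eqVneq.
- by move=> l; case: ifP.
- move=> x /sij sx H'; have := H' i; have := H' j.
  rewrite !eqxx [j == i]eq_sym (negbTE ij) => /andP[jx _] /andP[_ ix].
  by move: sx; rewrite /side ix ltNge (ltW jx).
- apply: (@prod_halve_le _ _ _ _ i j); rewrite ?eqxx.
  + by move=> l; rewrite subr_ge0.
  + by move=> l /negbTE -> /negbTE ->.
  + by rewrite (negbTE ij) /mid; field.
  + by rewrite [j == i]eq_sym (negbTE ij) /mid; field.
Qed.

(** Otherwise each of the [N] slabs holds at least [M.+1] points. Being disjoint, the slabs count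
    every point at most once, so [s] would have at least [N * M.+1] entries. *)
Lemma sparse_slab (R : realFieldType) (T : eqType) (f : T -> R) (s : seq T)
    (N M : nat) :
    (size s < N * M.+1)%N ->
  exists2 j : nat, (j < N)%N &
    (count (fun x => j%:R / N%:R < f x < j.+1%:R / N%:R)%R s <= M)%N.
Proof.
move=> sNM; apply: contrapT => nex.
have N0 : (0 < N)%N by case: N sNM {nex}.
have : (N * M.+1 <= \sum_(j < N)
    count (fun x => j%:R / N%:R < f x < j.+1%:R / N%:R)%R s)%N.
  rewrite -[X in (X * _)%N]card_ord -sum_nat_const; apply: leq_sum => j _.
  by rewrite ltnNge; apply/negP => jM; apply: nex; exists j.
apply/negP; rewrite -ltnNge (leq_ltn_trans _ sNM)//.
elim: s {sNM nex} => [|x s IHs] /=; first by rewrite big1.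
rewrite big_split/= -add1n leq_add// {IHs}.
have [j jx|nox] := pickP (fun j : 'I_N => j%:R / N%:R < f x < j.+1%:R / N%:R);
  last by rewrite big1// => j _; rewrite nox.
rewrite (bigD1 j)//= jx big1// => i ij; apply/eqP; rewrite eqb0.
(* A point in slabs [i] and [j] gives [i < j + 1] and [j < i + 1], hence [i = j]. *)
apply/negP => /andP[ix xi]; move/andP: jx => [jx xj].
have := lt_trans ix xj; have := lt_trans jx xi.
rewrite !ltr_pM2r ?invr_gt0 ?ltr0n// !ltr_nat !ltnS => ji ij'.
by move: ij; rewrite -val_eqE eqn_leq ji ij'.
Qed.

Lemma log2_lt_trunc_log (R : realType) (d : nat) :
  log2 (d%:R : R) < (trunc_log 2 d).+1%:R.
Proof.
have ln2 : 0 < ln (2 : R) by rewrite ln_gt0// ltr1n.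
rewrite /log2 ltr_pdivrMr//.
(* At [d = 0] the default value [ln 0 = 0] is used. *)
case: d => [|d]; first by rewrite ln0// mulr_gt0// ltr0n.
rewrite mulr_natl -lnXn// ltr_ln ?posrE ?exprn_gt0// -natrX ltr_nat.
exact: trunc_log_ltn.
Qed.

Lemma disp_ge (R : realType) (k n d : nat) (P : set (Rpoint R d)) :
    (0 < k)%N -> (0 < n)%N -> (0 < d)%N -> (P #= `I_n)%card ->
  ((8^-1 * Num.min 1 ((k%:R + log2 d%:R) / n%:R))%:E <= disp k P)%E.
Proof.
case: d P => // d P k0 n0 _ Pn.
have /finite_fsetP[F PF] : finite_set P by exists n.
have sF : size (finmap.enum_fset F) = n by apply/card_eq_fsetP; rewrite -PF.
pose m := trunc_log 2 d.+1.
(* The least [N] with [n < N * (k + m).+1], so that the sparse slab is as wide as possible. *)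
pose N := (n %/ (k + m).+1).+1.
have N0 : 0 < N%:R :> R by rewrite ltr0n.
have nN : (n < N * (k + m).+1)%N by rewrite ltn_ceil.
have [] := @sparse_slab R _ (fun x : Rpoint R d.+1 => tnth x ord0)
  (finmap.enum_fset F) N (k + m).
  by rewrite sF.
move=> j jN; set inslab := (fun x : Rpoint R d.+1 => _) => cnt.
pose t := [seq x <- finmap.enum_fset F | inslab x].
pose a (l : 'I_d.+1) : R := if l == ord0 then j%:R / N%:R else 0.
pose b (l : 'I_d.+1) : R := if l == ord0 then j.+1%:R / N%:R else 1.
have ab l : a l <= b l.
  by rewrite /a /b; case: ifP => // _; rewrite ler_pM2r ?invr_gt0// ler_nat.
have a0 l : 0 <= a l by rewrite /a; case: ifP => // _; rewrite divr_ge0.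
have b1 l : b l <= 1.
  by rewrite /b; case: ifP => // _; rewrite ler_pdivrMr// mul1r ler_nat.
(* At most [m] points of the slab remain after the first [k], and [2 ^ m <= d.+1]. *)
have [|lo [hi [alo lohi hib boxt boxvol]]] :=
    @empty_quarter_box R d.+1 a b (drop k t) ab.
  rewrite (leq_trans _ (@trunc_logP 2 d.+1 _ _))// leq_pexp2l//.
  by rewrite size_drop size_filter leq_subLR.
apply: le_trans (ereal_sup_ubound _); last first.
  exists (open_box R d.+1 lo hi); last by rewrite vol_open_box.
  split.
    by apply: axis_open_box => l; [exact: le_trans (alo l)|exact: le_trans (b1 l)].
  (* The points of [P] in the box lie in the slab and are not among those avoided, so they are among
     the first [k] entries of [t]; [x0] is only a default for [nth]. *)
  pose x0 : Rpoint R d.+1 := [tuple of nseq d.+1 0].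
  apply: card_le_trans (card_image_le (nth x0 t) `I_k).
  apply: subset_card_le => x [Px Bx].
  have : x \in t.
    rewrite mem_filter; apply/andP; split; last by move: Px; rewrite PF.
    have /andP[ax xb] := Bx ord0; have := alo ord0; have := hib ord0.
    rewrite /a /b eqxx => hib0 alo0; rewrite /inslab.
    by rewrite (le_lt_trans alo0 ax) (lt_le_trans xb hib0).
  rewrite -{1}(cat_take_drop k t) mem_cat => /orP[|/boxt//].
  move=> /(nthP x0)[r]; rewrite size_take_min leq_min => /andP[rk _] <-.
  by exists r => //; rewrite nth_take.
rewrite lee_fin (le_trans _ boxvol)//.
rewrite big_ord_recl big1 ?mulr1; last by move=> l _; rewrite /a /b /= subr0.
rewrite /a /b eqxx -mulrBl -natrB// subSnn mul1r.
have n0' : 0 < n%:R :> R by rewrite ltr0n.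
have logm : log2 (d.+1%:R : R) < m%:R + 1.
  by rewrite [ltRHS]natr1 log2_lt_trunc_log.
have Nn : (N * (k + m).+1 <= n + (k + m).+1)%N.
  by rewrite /N mulSn addnC leq_add2r leq_trunc_div.
have Nn' : N%:R * (k%:R + m%:R + 1) <= n%:R + (k%:R + m%:R + 1) :> R.
  by move: Nn; rewrite -(ler_nat R) natrM natrD -addn1 !natrD.
have lg0 : 0 <= log2 (d.+1%:R : R).
  by rewrite /log2 divr_ge0// ln_ge0// ler1n.
set c := k%:R + log2 _.
have k0' : 0 < k%:R :> R by rewrite ltr0n.
have c0 : 0 < c by apply: ltr_pwDl.
set M := k%:R + m%:R + 1 in Nn'.
have cM : c < M by rewrite /c /M -addrA ltrD2l.
rewrite -ler_pdivlMl ?invr_gt0// invrK mulrA.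
rewrite (_ : 8 * 4^-1 = 2); last by field.
(* It remains to bound the minimum by [2 / N], using [N * M <= n + M]. If [n <= M], then [N <= 2];
   otherwise [N * c <= N * M < 2 * n]. *)
rewrite ge_min; have [nM|Mn] := leP n%:R M.
  apply/orP; left; rewrite ler_pdivlMr// mul1r.
  by rewrite -(ler_pM2r (lt_trans c0 cM)); lra.
apply/orP; right; rewrite ler_pdivrMr// mulrAC ler_pdivlMr//.
have : N%:R * c <= N%:R * M by rewrite ler_pM2l// ltW.
lra.
Qed.

Theorem theorem2 (R : realType) (k n d : nat)
  (hk : (0 < k)%N) (hn : (0 < n)%N) (hd : (0 < d)%N) :
  ((8^-1 * Num.min 1 ((k%:R + log2 d%:R) / n%:R))%:E <= disp_min R k n d)%E.
Proof.
by apply: le_ereal_inf_tmp => _ [P [_ Pn] <-]; exact: disp_ge.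
Qed.
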